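(* Let $K\subset\mathbb{R}^m$ be a compact set with zero Lebesgue measure and let $\omega$ be a continuity modulus as in the context. For $\delta>0$ denote by $K_\delta$ the $\delta$-neighborhood of $K$ in $\mathbb{R}^m$. Suppose that for a function $f(X)$, $X\in K$, for any $\delta>0$ (equivalently, for a sequence of such $\delta$ tending to zero), there exists a function $v_\delta$ on $K_\delta$ such that $$|f(X)-v_\delta(X)|\le c_1\,\omega(\delta),\qquad X\in K,$$ and $$|\nabla v_\delta(X)|\le c_2\,\omega(\delta)\,\delta^{-1},\qquad X\in K_\delta,$$ with some constants $c_1,c_2$ not depending on $\delta$ (but depending, generally, on the function $f$). Then $f\in C^{\omega}(K)$.
   Context: Continuity modulus: a continuous nondecreasing function $\omega:[0,\infty)\to[0,\infty)$ with $\omega(0)=0$ and $\omega(t)>0$ for $t>0$; here it is assumed to be concave, with $\omega(t)/t$ decaying (nonincreasing), and to satisfy, for some constants $C',C''$ and all $t>0$, $$\int_0^t\frac{\omega(\tau)}{\tau}\,d\tau\le C'\omega(t),\qquad \int_t^\infty\frac{\omega(\tau)}{\tau^2}\,d\tau\le C''\frac{\omega(t)}{t}.$$ $C^\omega(K)$ is the space of continuous functions on $K$ with continuity modulus $\omega$, i.e. functions $f$ on $K$ for which there is a constant $C$ with $|f(X_1)-f(X_2)|\le C\omega(|X_1-X_2|)$ for all $X_1,X_2\in K$. The $\delta$-neighborhood is $K_\delta=\bigcup_{X\in K}B_\delta(X)$, where $B_\delta(X)$ is the open ball of radius $\delta$ centered at $X$. The functions $v_\delta$ are understood to be differentiable on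 $K_\delta$, so that the gradient bound makes sense. *)

(* Defs.v *)
From HB Require Import structures.
From mathcomp Require Import all_boot all_order all_algebra.
From mathcomp Require Import all_classical all_reals all_analysis.

Set Implicit Arguments.
Unset Strict Implicit.
Unset Printing Implicit Defensive.

Import Order.TTheory GRing.Theory Num.Theory.
Import numFieldNormedType.Exports.

Local Open Scope classical_set_scope.
Local Open Scope ring_scope.

(* The norm carried by 'rV[R]_m in the library is the sup norm.  It induces the
   usual topology, so [compact] and [differentiable] are the usual notions, but
   distances, balls and gradient lengths below use the Euclidean norm. *)
Definition enorm (R : realType) (m : nat) (x : 'rV[R]_m) : R :=
  Num.sqrt (\sum_(i < m) x ord0 i ^+ 2).

Definition eball (R : realType) (m : nat) (X : 'rV[R]_m) (delta : R) :
    set 'rV[R]_m :=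
  [set Y | enorm (Y - X) < delta].

Definition neighborhood (R : realType) (m : nat) (K : set 'rV[R]_m)
    (delta : R) : set 'rV[R]_m :=
  \bigcup_(X in K) eball X delta.

Definition gradient (R : realType) (m : nat) (v : 'rV[R]_m -> R)
    (X : 'rV[R]_m) : 'rV[R]_m :=
  \row_(i < m) 'D_(delta_mx ord0 i) v X.

Definition box (R : realType) (m : nat) (a b : 'rV[R]_m) : set 'rV[R]_m :=
  [set x | forall i, a ord0 i <= x ord0 i <= b ord0 i].

Definition box_volume (R : realType) (m : nat) (a b : 'rV[R]_m) : R :=
  \prod_(i < m) (b ord0 i - a ord0 i).

(* The library has no Lebesgue measure on 'rV[R]_m; this is the m-dimensional
   Lebesgue outer measure (for 0 < m), which is the Lebesgue measure on
   measurable sets. *)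
Definition lebesgue_outer (R : realType) (m : nat) (A : set 'rV[R]_m) :
    \bar R :=
  ereal_inf [set s : \bar R | exists a b : nat -> 'rV[R]_m,
    [/\ forall k i, a k ord0 i <= b k ord0 i,
        A `<=` \bigcup_k box (a k) (b k) &
        s = (\sum_(0 <= k <oo) (box_volume (a k) (b k))%:E)%E]].

(* Only the values of omega on [0, +oo[ are relevant. *)
Record continuity_modulus (R : realType) (omega : R -> R) : Prop := {
  modulus_ge0 : forall t, 0 <= t -> 0 <= omega t ;
  modulus_continuous : {within `[0, +oo[, continuous omega} ;
  modulus_nondecreasing : forall s t, 0 <= s -> s <= t -> omega s <= omega t ;
  modulus0 : omega 0 = 0 ;
  modulus_gt0 : forall t, 0 < t -> 0 < omega t }.

Record regular_modulus (R : realType) (omega : R -> R) : Prop := {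
  regular_is_modulus : continuity_modulus omega ;
  regular_concave :
    convex_function (`[0, +oo[%classic : set R) (fun t : R => - omega t) ;
  regular_ratio :
    forall s t, 0 < s -> s <= t -> omega t / t <= omega s / s ;
  regular_integral0 : exists C' : R, forall t, 0 < t ->
    (\int[@lebesgue_measure R]_(tau in `]0%R, t]) (omega tau / tau)%:E
       <= (C' * omega t)%:E)%E ;
  regular_integral_infty : exists C'' : R, forall t, 0 < t ->
    (\int[@lebesgue_measure R]_(tau in `[t, +oo[) (omega tau / tau ^+ 2)%:E
       <= (C'' * (omega t / t))%:E)%E }.

(* Functions on K are represented by total functions of which only the values
   on K matter.  Continuity on K follows from the estimate, as omega is
   continuous at 0 with omega 0 = 0. *)
Definition C_omega (R : realType) (m : nat) (omega : R -> R)
    (K : set 'rV[R]_m) : set ('rV[R]_m -> R) :=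
  [set f | exists C : R, forall X1 X2, K X1 -> K X2 ->
    `|f X1 - f X2| <= C * omega (enorm (X1 - X2))].

(* Main.v *)
Require Import Defs.
From mathcomp Require Import all_boot all_order all_algebra.
From mathcomp Require Import all_classical all_reals all_analysis.
From mathcomp Require Import ring lra.
Import Order.TTheory GRing.Theory Num.Theory.
Import numFieldNormedType.Exports.
Local Open Scope classical_set_scope.
Local Open Scope ring_scope.

(** Two points [X1], [X2] of [K] at distance [d > 0] lie, together with the
    segment joining them, in the [2d]-neighborhood of [K].  By the mean value
    theorem [v_{2d}] varies by at most [c2 * omega (2d) / 2] along the segment,
    so that [f] varies by at most [(2 c1 + c2 / 2) * omega (2d)]; and
    [omega (2d) <= 2 omega d] because [omega t / t] is nonincreasing. *)

Lemma enorm_ge0 {R : realType} {m : nat} (x : 'rV[R]_m) : 0 <= enorm x.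
Proof. exact: sqrtr_ge0. Qed.

Lemma sqr_enorm {R : realType} {m : nat} (x : 'rV[R]_m) :
  enorm x ^+ 2 = \sum_(i < m) x ord0 i ^+ 2.
Proof. by rewrite sqr_sqrtr// sumr_ge0// => i _; rewrite sqr_ge0. Qed.

Lemma enormZ {R : realType} {m : nat} (a : R) (x : 'rV[R]_m) :
  enorm (a *: x) = `|a| * enorm x.
Proof.
rewrite /enorm -sqrtr_sqr -sqrtrM ?sqr_ge0// mulr_sumr.
by congr Num.sqrt; apply: eq_bigr => i _; rewrite mxE exprMn.
Qed.

Lemma enorm_eq0P {R : realType} {m : nat} {x : 'rV[R]_m} : enorm x = 0 -> x = 0.
Proof.
move=> x0; apply/rowP => i; apply/eqP; rewrite mxE -sqrf_eq0; apply/eqP.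
have := sqr_enorm x; rewrite x0 expr0n/= => /esym/psumr_eq0P; apply => //.
by move=> j _; rewrite sqr_ge0.
Qed.

Lemma enorm_cauchy_schwarz {R : realType} {m : nat} (u v : 'rV[R]_m) :
  `|\sum_(i < m) u ord0 i * v ord0 i| <= enorm u * enorm v.
Proof.
set S := \sum_(i < m) _.
have [v0|v_neq0] := eqVneq (enorm v) 0.
  rewrite v0 mulr0 /S big1 ?normr0// => i _.
  by rewrite (enorm_eq0P v0) mxE mulr0.
have v_gt0 : 0 < enorm v by rewrite lt0r v_neq0 enorm_ge0.
rewrite -(ler_pXn2r (n := 2)) ?nnegrE ?mulr_ge0 ?enorm_ge0//.
rewrite real_normK ?num_real// exprMn -subr_ge0.
rewrite -(pmulr_rge0 _ (exprn_gt0 2 v_gt0)).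
(* The vector [enorm v ^+ 2 *: u - S *: v] is [enorm v ^+ 2] times the component of [u] orthogonal
   to [v]; expanding its squared length gives the left-hand side, which is therefore nonnegative. *)
have -> : enorm v ^+ 2 * (enorm u ^+ 2 * enorm v ^+ 2 - S ^+ 2) =
    \sum_(i < m) (enorm v ^+ 2 * u ord0 i - S * v ord0 i) ^+ 2.
  transitivity (\sum_(i < m) (enorm v ^+ 4 * u ord0 i ^+ 2
      + - 2 * enorm v ^+ 2 * S * (u ord0 i * v ord0 i)
      + S ^+ 2 * v ord0 i ^+ 2)); last by apply: eq_bigr => i _; ring.
  rewrite !big_split/= -!mulr_sumr -!sqr_enorm -/S; ring.
by rewrite sumr_ge0// => i _; rewrite sqr_ge0.
Qed.

Lemma derive_gradient {R : realType} {m : nat} {v : 'rV[R]_m -> R}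
    {X h : 'rV[R]_m} : differentiable v X ->
  'D_h v X = \sum_(i < m) gradient v X ord0 i * h ord0 i.
Proof.
move=> dv; rewrite deriveE// [in LHS](row_sum_delta h) linear_sum.
by apply: eq_bigr => i _; rewrite linearZ mxE deriveE// mulrC.
Qed.

(** The difference quotient at [t] of the restriction of [v] to the line is, as a function of the
    increment, the one that defines ['D_h v] at [X + t *: h]. So derivability and the value carry
    over together. *)
Lemma is_derive_line {R : realType} {m : nat} {v : 'rV[R]_m -> R}
    {X h : 'rV[R]_m} {t : R} : differentiable v (X + t *: h) ->
  is_derive t 1 (fun s : R => v (X + s *: h)) ('D_h v (X + t *: h)).
Proof.
move=> /(@diff_derivable _ _ _ _ _ h).
have E : (fun s => s^-1 *: (((fun s : R => v (X + s *: h)) \o shift t) (s *: 1)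
      - v (X + t *: h))) =
    (fun s => s^-1 *: ((v \o shift (X + t *: h)) (s *: h) - v (X + t *: h))).
  apply/funext => s /=; congr (_ *: (v _ - _)).
  by rewrite [s *: 1]mulr1 scalerDl addrCA.
by move=> dv; split; rewrite /derivable /derive E.
Qed.

(** The one-variable mean value theorem on [[0, 1]] turns the increment into the inner product of
    [h] with a gradient on the segment, and Cauchy-Schwarz bounds it. Everything is assumed on the
    segment only, since a neighborhood of [K] need not be convex. *)
Lemma mean_value_gradient {R : realType} {m : nat} {v : 'rV[R]_m -> R}
    {X h : 'rV[R]_m} {M : R} :
  (forall t : R, 0 <= t <= 1 -> differentiable v (X + t *: h)) ->
  (forall t : R, 0 <= t <= 1 -> enorm (gradient v (X + t *: h)) <= M) ->
  `|v (X + h) - v X| <= M * enorm h.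
Proof.
move=> dv boundM.
have dg (t : R) : t \in `[0, 1] ->
    is_derive t 1 (fun s : R => v (X + s *: h)) ('D_h v (X + t *: h)).
  by rewrite in_itv/= => t01; exact/is_derive_line/dv.
have cg : {within `[0, 1], continuous (fun s : R => v (X + s *: h))}.
  by apply: derivable_within_continuous => s /dg[].
have [t] := MVT_segment ler01 (fun t t01 => dg t (subset_itv_oo_cc t01)) cg.
rewrite in_itv/= => t01.
rewrite scale1r scale0r addr0 subr0 mulr1 => ->.
rewrite (derive_gradient (dv _ t01)).
apply: le_trans (enorm_cauchy_schwarz _ _) _.
by rewrite ler_wpM2r ?enorm_ge0// boundM.
Qed.

Lemma regular_modulus_double {R : realType} {omega : R -> R} {t : R} :
  regular_modulus omega -> 0 < t -> omega (2 * t) <= 2 * omega t.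
Proof.
move=> om t0; have t20 : 0 < 2 * t by lra.
have : omega (2 * t) / (2 * t) <= omega t / t.
  by apply: (regular_ratio om) => //; lra.
rewrite ler_pdivrMr// => /le_trans; apply.
by rewrite mulrCA divfK// gt_eqF.
Qed.

Theorem theorem3p1 (R : realType) (m : nat) (m_gt0 : (0 < m)%N)
    (K : set 'rV[R]_m) (compactK : compact K)
    (nullK : lebesgue_outer K = 0%E)
    (omega : R -> R) (omega_mod : regular_modulus omega)
    (f : 'rV[R]_m -> R) (c1 c2 : R)
    (approx : forall delta : R, 0 < delta ->
      exists v : 'rV[R]_m -> R,
        [/\ forall X, K X -> `|f X - v X| <= c1 * omega delta,
            forall X, neighborhood K delta X -> differentiable v X &
            forall X, neighborhood K delta X ->
              enorm (gradient v X) <= c2 * omega delta * delta^-1]) :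
  C_omega omega K f.
Proof.
(* This is [2 * (2 c1 + c2 / 2)], the factor 2 coming from the doubling of [omega]. Absolute values
   appear because the signs of [c1] and [c2] are not prescribed. *)
exists (4 * `|c1| + `|c2|) => X1 X2 KX1 KX2.
set d := enorm (X1 - X2).
(* Coinciding points are treated apart, as [approx] requires a positive radius. *)
have [d0|d_neq0] := eqVneq d 0.
  rewrite d0 (modulus0 (regular_is_modulus omega_mod)) mulr0.
  by have /subr0_eq -> := enorm_eq0P d0; rewrite subrr normr0.
have d_gt0 : 0 < d by rewrite lt0r d_neq0 enorm_ge0.
have d2_gt0 : 0 < 2 * d by lra.
have [v [fv dv gv]] := approx _ d2_gt0.
(* Each point of the segment is at distance [t * d <= d] from [X2]. The radius [2 * d] makes this
   strict, so one open ball around [X2] contains the whole closed segment. *)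
have segment t : 0 <= t <= 1 -> neighborhood K (2 * d) (X2 + t *: (X1 - X2)).
  move=> /andP[t0 t1]; exists X2 => //.
  rewrite /eball/= addrAC subrr add0r enormZ ger0_norm// -/d.
  by rewrite ltr_pM2r//; lra.
have := mean_value_gradient (fun t t01 => dv _ (segment t t01))
  (fun t t01 => gv _ (segment t t01)).
rewrite (addrC X2) subrK -/d.
have -> : c2 * omega (2 * d) * (2 * d)^-1 * d = c2 * omega (2 * d) / 2.
  by field; rewrite d_neq0.
move=> v12; have fv1 := fv _ KX1; have fv2 := fv _ KX2.
have w2 := regular_modulus_double omega_mod d_gt0.
have w0 : 0 <= omega (2 * d).
  exact: (modulus_ge0 (regular_is_modulus omega_mod)) (ltW d2_gt0).
(* Passing to the absolute value first makes the factor nonnegative, so that the doubling inequality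
   can be multiplied by it. *)
have c1w : c1 * omega (2 * d) <= `|c1| * (2 * omega d).
  by apply: le_trans (ler_wpM2r w0 (ler_norm c1)) (ler_wpM2l _ w2).
have c2w : c2 * omega (2 * d) <= `|c2| * (2 * omega d).
  by apply: le_trans (ler_wpM2r w0 (ler_norm c2)) (ler_wpM2l _ w2).
have -> : f X1 - f X2 = (f X1 - v X1) + (v X1 - v X2) - (f X2 - v X2) by ring.
apply: le_trans (ler_normB _ _) _.
apply: le_trans (lerD (ler_normD _ _) (lexx _)) _.
lra.
Qed.
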